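(* Let $n\ge2$ and let $(G,R)$ be an abelian cyclically ordered group. Then $G$ is $n$-regular if and only if one of the two following conditions is satisfied: (1) $G$ is linearly cyclically ordered, and is an $n$-regular linearly ordered group; (2) $G$ is not linearly cyclically ordered, and is c-$n$-regular. In other words, the class of $n$-regular cyclically ordered groups is the union of the class of $n$-regular linearly cyclically ordered groups and of the class of c-$n$-regular cyclically ordered groups.
   Context: All groups are abelian, written additively. A cyclically ordered group $(G,R)$ is an abelian group $G$ with a ternary relation $R$ such that: $R(a,b,c)$ implies that $a,b,c$ are pairwise distinct; $R(a,b,c)\Rightarrow R(b,c,a)$; for every $c\in G$, $R(c,\cdot,\cdot)$ is a strict linear order on $G\setminus\{c\}$; $R(a,b,c)\Rightarrow R(a+u,b+u,c+u)$. A linearly ordered group $(G,<)$ becomes a cyclically ordered group by setting $R(a,b,c)$ iff $a<b<c$ or $b<c<a$ or $c<a<b$; the cyclically ordered groups obtained in this way are called linearly cyclically ordered. $R(x_1,\dots,x_m)$ (with $m\ge3$) means that $R(x_i,x_j,x_k)$ holds for all $1\le i<j<k\le m$. $(G,R)$ is $n$-regular if for all $x_1,\dots,x_n\in G$ with $R(0,x_1,\dots,x_n,-x_n)$ there is $x\in G$ such that ($R(x_1,nx,x_n)$ or $nx=x_1$ or $nx=x_n$) and $R(0,x,\dots,(n-1)x,x_n)$. $(G,R)$ is c-$n$-regular if the same conclusion holds for all $x_1,\dots,x_n\in G$ with $R(0,x_1,\dots,x_n)$. A linearly ordered abelian group is $n$-regular if for all $0<x_1<\cdots<x_n$ there is $x$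 with $x_1\le nx\le x_n$. *)

(* Defs.v *)
From mathcomp Require Import all_boot all_algebra.
Set Implicit Arguments.
Unset Strict Implicit.
Unset Printing Implicit Defensive.
Import GRing.Theory.
Local Open Scope ring_scope.

Definition strict_linear_order_on (T : Type) (D : T -> Prop)
    (lt : T -> T -> Prop) : Prop :=
  [/\ forall a, D a -> ~ lt a a,
      forall a b c, D a -> D b -> D c -> lt a b -> lt b c -> lt a c
    & forall a b, D a -> D b -> a <> b -> lt a b \/ lt b a].

Definition is_cyclic_order (G : zmodType) (R : G -> G -> G -> Prop) : Prop :=
  [/\ forall a b c, R a b c -> [/\ a <> b, b <> c & a <> c],
      forall a b c, R a b c -> R b c a,
      forall c, strict_linear_order_on (fun a => a <> c) (R c)
    & forall a b c u, R a b c -> R (a + u) (b + u) (c + u)].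

Definition is_linear_group_order (G : zmodType) (lt : G -> G -> Prop) : Prop :=
  strict_linear_order_on (fun=> True) lt
  /\ forall a b u, lt a b -> lt (a + u) (b + u).

Definition induced_by (G : zmodType) (lt : G -> G -> Prop)
    (R : G -> G -> G -> Prop) : Prop :=
  is_linear_group_order lt
  /\ forall a b c, R a b c <->
       [\/ lt a b /\ lt b c, lt b c /\ lt c a | lt c a /\ lt a b].

Definition linearly_cyclically_ordered (G : zmodType)
    (R : G -> G -> G -> Prop) : Prop :=
  exists lt : G -> G -> Prop, induced_by lt R.

(* R(x_1, ..., x_m), for s = [:: x_1; ...; x_m]; only used with m >= 3. *)
Definition cyclic_seq (G : zmodType) (R : G -> G -> G -> Prop)
    (s : seq G) : Prop :=
  forall i j k : nat, (i < j)%N -> (j < k)%N -> (k < size s)%N ->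
    R s`_i s`_j s`_k.

(* The common conclusion of the two regularity properties, where x1 and xn are
   the first and last terms of the given n-tuple. *)
Definition has_nth_part (G : zmodType) (n : nat) (R : G -> G -> G -> Prop)
    (x1 xn : G) : Prop :=
  exists x : G,
    [\/ R x1 (x *+ n) xn, x *+ n = x1 | x *+ n = xn]
    /\ cyclic_seq R (rcons (mkseq (fun i => x *+ i) n) xn).

(* In the three regularity properties, head 0 x and last 0 x are x_1 and x_n:
   the default value 0 is irrelevant as soon as n > 0. *)
Definition n_regular (G : zmodType) (n : nat)
    (R : G -> G -> G -> Prop) : Prop :=
  forall x : n.-tuple G,
    cyclic_seq R (0 :: rcons x (- last 0 x)) ->
    has_nth_part n R (head 0 x) (last 0 x).

Definition c_n_regular (G : zmodType) (n : nat)
    (R : G -> G -> G -> Prop) : Prop :=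
  forall x : n.-tuple G,
    cyclic_seq R (0 :: x) -> has_nth_part n R (head 0 x) (last 0 x).

(* s_0 < s_1 < ... < s_m; Prop-valued counterpart of sorted. *)
Definition increasing_seq (G : zmodType) (lt : G -> G -> Prop)
    (s : seq G) : Prop :=
  forall i : nat, (i.+1 < size s)%N -> lt s`_i s`_i.+1.

Definition linear_n_regular (G : zmodType) (n : nat)
    (lt : G -> G -> Prop) : Prop :=
  forall x : n.-tuple G,
    increasing_seq lt (0 :: x) ->
    exists y : G,
      (lt (head 0 x) (y *+ n) \/ head 0 x = y *+ n)
      /\ (lt (y *+ n) (last 0 x) \/ y *+ n = last 0 x).

(* The linear order inducing R is unique (0 < x iff R(-x, 0, x)), so this does
   not depend on the choice of lt. *)
Definition n_regular_linearly_cyclically_ordered (G : zmodType) (n : nat)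
    (R : G -> G -> G -> Prop) : Prop :=
  exists lt : G -> G -> Prop, induced_by lt R /\ linear_n_regular n lt.

(* Main.v *)
Require Import Defs.
From mathcomp Require Import all_boot all_algebra.
From Stdlib Require Import Classical.

Set Implicit Arguments.
Unset Strict Implicit.
Unset Printing Implicit Defensive.
Import GRing.Theory.
Local Open Scope ring_scope.

(* Unwind G to a linearly ordered group H with a positive element z such that
   G = H / <z>, elements of G being represented in [0, z[. Suppose that
   0 < x_1 < ... < x_n < z and that no x satisfies x_1 <= n x <= x_n.
   - If 2 n w < z, then w is infinitesimal (k w < z for all k): as long as
     k n w < x_1, regularity applied to the x_i - k n w shows that
     (k + 1) n w < x_1.
   - Unless G is linear, some w is standard, i.e. neither w nor -w is
     infinitesimal. Choose w such that the number of its multiples below z is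
     maximal, which is possible since this number is less than 2 n; then no
     standard u satisfies 2 u <= w. If there is an infinitesimal d <> 0,
     regularity fails for w - (n - 1) d < ... < w - d < w, up to replacing w
     with -w or w - d so that 2 w < z. If there is none, then w is the least
     nonzero element, so the x_i are multiples of w, and some multiple of n w
     lies between x_1 and x_n. *)

Section CyclicOrder.
Variables (G : zmodType) (R : G -> G -> G -> Prop).
Hypothesis hR : is_cyclic_order R.
Implicit Types (a b c d u v w x y : G) (j k n : nat).

(** * The axioms in usable form *)

Lemma cyc_neq a b c : R a b c -> [/\ a <> b, b <> c & a <> c].
Proof. by case: hR => H _ _ _; apply: H. Qed.

Lemma cyc_rot a b c : R a b c -> R b c a.
Proof. by case: hR => _ H _ _; apply: H. Qed.

Lemma cyc_shift u a b c : R a b c -> R (a + u) (b + u) (c + u).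
Proof. by case: hR => _ _ _ H; apply: H. Qed.

Lemma cyc_trans c a b d : R c a b -> R c b d -> R c a d.
Proof.
move=> cab cbd; have [ca _ cb] := cyc_neq cab; have [_ _ cd] := cyc_neq cbd.
case: hR => _ _ /(_ c)[_ tr _] _.
by apply: (tr a b d) => //; apply: nesym.
Qed.

Lemma cyc_asym a b c : R a b c -> ~ R a c b.
Proof. by move=> abc /(cyc_trans abc) /cyc_neq[_]. Qed.

Lemma cyc_total a b c : a <> b -> b <> c -> a <> c -> R a b c \/ R a c b.
Proof.
move=> ab bc ac; case: hR => _ _ /(_ a)[_ _ tot] _.
by apply: tot => //; apply: nesym.
Qed.

(* The linear order obtained by cutting the circle at 0, with 0 as least
   element: G is then identified with the interval [0, z[ of its unwound
   linearly ordered cover, where z is one full turn. *)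
Definition cut_lt a b : Prop := R 0 a b \/ (a = 0 /\ b <> 0).
Definition cut_le a b : Prop := a = b \/ cut_lt a b.
Local Notation "a ≺ b" := (cut_lt a b) (at level 70).
Local Notation "a ≼ b" := (cut_le a b) (at level 70).

(** * The total order cut at 0, and its relation to [R] *)

Lemma cut_lt_neq a b : a ≺ b -> a <> b.
Proof. by case=> [/cyc_neq[] //|[->] /nesym]. Qed.

Lemma cut_lt_neq0 a b : a ≺ b -> b <> 0.
Proof. by case=> [/cyc_neq[_ _ /nesym]|[]]. Qed.

Lemma cut_lt_trans a b c : a ≺ b -> b ≺ c -> a ≺ c.
Proof.
move=> ab bc; have c0 := cut_lt_neq0 bc; case: ab => [ab|[-> _]]; last by right.
case: bc => [bc|[b0 _]]; first by left; apply: cyc_trans bc.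
by case: (cyc_neq ab) => _ _; rewrite b0.
Qed.

Lemma cut_lt_irr a : ~ a ≺ a.
Proof. by move/cut_lt_neq. Qed.

Lemma cut_lt_total a b : [\/ a ≺ b, a = b | b ≺ a].
Proof.
have [->|/eqP ab] := eqVneq a b; first by constructor 2.
have [->|/eqP a0] := eqVneq a 0.
  have [->|/eqP b0] := eqVneq b 0; first by constructor 2.
  by constructor 1; right.
have [->|/eqP b0] := eqVneq b 0; first by constructor 3; right.
case: (cyc_total (nesym a0) ab (nesym b0)) => ?.
  by constructor 1; left.
by constructor 3; left.
Qed.

Lemma cut_le_refl a : a ≼ a. Proof. by left. Qed.
Lemma cut_ltW a b : a ≺ b -> a ≼ b. Proof. by right. Qed.

Lemma cut_le_lt_trans a b c : a ≼ b -> b ≺ c -> a ≺ c.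
Proof. by case=> [->|] //; apply: cut_lt_trans. Qed.

Lemma cut_lt_le_trans a b c : a ≺ b -> b ≼ c -> a ≺ c.
Proof. by move=> ab [<-|] //; apply: cut_lt_trans. Qed.

Lemma cut_le_trans a b c : a ≼ b -> b ≼ c -> a ≼ c.
Proof. by case=> [->|ab] // bc; right; apply: cut_lt_le_trans bc. Qed.

Lemma cut_le_or_lt a b : a ≼ b \/ b ≺ a.
Proof. by case: (cut_lt_total a b) => ?; [left; right|left; left|right]. Qed.

Lemma cut_le_total a b : a ≼ b \/ b ≼ a.
Proof. by case: (cut_le_or_lt a b) => ?; [left|right; right]. Qed.

Lemma cut_le_not_lt a b : a ≼ b -> ~ b ≺ a.
Proof. by move=> ab /(cut_le_lt_trans ab)/cut_lt_irr. Qed.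

Lemma cut_le0 a : 0 ≼ a.
Proof. by have [->|/eqP ?] := eqVneq a 0; [left|right; right]. Qed.

Lemma cut_lt0 a : a <> 0 -> 0 ≺ a.
Proof. by right. Qed.

Lemma cut_lt_cyc a b c : a ≺ b -> b ≺ c -> R a b c.
Proof.
move=> ab [bc|[b0 _]]; last by case/cut_lt_neq0: ab.
case: ab => [ab|[-> //]].
apply: cyc_rot; apply: cyc_rot.
exact: cyc_trans (cyc_rot bc) (cyc_rot (cyc_rot ab)).
Qed.

Lemma cyc_between a b c : a ≺ c -> R a b c -> a ≺ b /\ b ≺ c.
Proof.
move=> ac abc; have [ab bc _] := cyc_neq abc.
case: (cut_lt_total a b) => // ba; last first.
  by case: (cyc_asym abc); apply: cyc_rot; apply: cut_lt_cyc.
case: (cut_lt_total b c) => // cb.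
by case: (cyc_asym abc); apply: cut_lt_cyc.
Qed.

(** * Opposites and carry-free addition in the cut order *)

Lemma cyc_sub a b : R 0 a b -> R 0 (b - a) (- a).
Proof.
by move/(cyc_shift (- a)); rewrite addrN add0r => /cyc_rot.
Qed.

Lemma cyc_opp a b : R 0 a b -> R 0 (- b) (- a).
Proof.
move=> ab; have [a0 nab b0] := cyc_neq ab.
case: (@cyc_total 0 (- b) (- a)) => //.
- by move/esym/eqP; rewrite oppr_eq0 => /eqP/esym.
- by move/oppr_inj/esym.
- by move/esym/eqP; rewrite oppr_eq0 => /eqP/esym.
move=> nanb.
(* Otherwise -b < a-b < a < b < b-a < -a < -b in the order cut at 0. *)
have h1 := cyc_sub ab; have h2 := cyc_sub h1.
have h3 := cyc_sub nanb; have h4 := cyc_sub h3.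
rewrite !opprK in h2 h3 h4.
have e1 : - a - (b - a) = - b by rewrite opprB addKr.
have e2 : a - (- b + a) = b by rewrite opprD opprK addrCA subrr addr0.
rewrite e1 in h2; rewrite e2 in h4.
rewrite opprB [a - b]addrC in h2; rewrite opprD opprK in h4.
case: (cyc_asym nanb); apply: (cyc_trans h2); apply: (cyc_trans h3).
by apply: (cyc_trans ab); apply: (cyc_trans h4).
Qed.

Lemma cut_lt_opp a b : a <> 0 -> a ≺ b -> - b ≺ - a.
Proof. by move=> a0 [ab|[]] //; left; apply: cyc_opp. Qed.

(* The sum of a and b, computed in the cover, is less than one turn. *)
Definition nocarry a b : Prop := a ≼ a + b.

(** In the cover, a + b < z means b < z - a, and [- a] represents z - a except when a = 0, where it
    represents 0. *)
Lemma nocarryE a b : nocarry a b <-> (a = 0 \/ b ≺ - a).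
Proof.
have [->|/eqP a0] := eqVneq a 0.
  by split=> _; [left|rewrite /nocarry add0r; apply: cut_le0].
have na0 : - a <> 0 by move/eqP; rewrite oppr_eq0 => /eqP.
have [->|/eqP b0] := eqVneq b 0.
  by split=> _; [right; right|rewrite /nocarry addr0; left].
split=> [[/eqP|[aab|[]//]]|[]// [bna|[]//]].
- by rewrite -subr_eq0 opprD addNKr oppr_eq0 => /eqP.
- by right; left; have := cyc_sub aab; rewrite addrAC addrN add0r.
(* On pairs, [cyc_sub] acts as a map of order three, so two applications undo the one made above. *)
right; left; have := cyc_sub (cyc_sub bna).
by rewrite !opprD !opprK [a + b]addrC addKr.
Qed.

Lemma nocarryC a b : nocarry a b -> nocarry b a.
Proof.
have [->|/eqP b0] := eqVneq b 0; first by rewrite !nocarryE => _; left.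
rewrite !nocarryE => -[->|bna]; right.
  by apply: cut_lt0; move/eqP; rewrite oppr_eq0 => /eqP.
by have := cut_lt_opp b0 bna; rewrite opprK.
Qed.

Lemma nocarry0r a : nocarry a 0.
Proof. by rewrite /nocarry addr0; left. Qed.

Lemma nocarry_subr a b : a ≼ b -> nocarry a (b - a).
Proof. by rewrite /nocarry subrKC. Qed.

Lemma nocarry_ltr a b c : nocarry a c -> b ≺ c -> nocarry a b.
Proof.
rewrite !nocarryE => -[->|cna] bc; first by left.
by right; apply: cut_lt_trans cna.
Qed.

Lemma nocarry_ler a b c : nocarry a c -> b ≼ c -> nocarry a b.
Proof. by move=> ac [->//|]; apply: nocarry_ltr. Qed.

Lemma nocarry_le a b c d : nocarry a c -> b ≼ a -> d ≼ c -> nocarry b d.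
Proof.
by move=> /nocarry_ler ac ba /ac/nocarryC/nocarry_ler/(_ ba)/nocarryC.
Qed.

Lemma nocarry_lt_add a b : nocarry a b -> b <> 0 -> a ≺ a + b.
Proof. by case=> // /eqP; rewrite -subr_eq0 opprD addNKr oppr_eq0 => /eqP. Qed.

(** Translation by a only preserves the cyclic relation, giving [R a (a + b) (a + c)]; since a + c
    does not wrap, a ≺ a + c, and [cyc_between] recovers the order. *)
Lemma cut_lt_add2l a b c : nocarry a c -> b ≺ c -> a + b ≺ a + c.
Proof.
move=> ac bc.
have [->|/eqP a0] := eqVneq a 0; first by rewrite !add0r.
have [->|/eqP b0] := eqVneq b 0.
  by rewrite addr0; apply: (nocarry_lt_add ac); apply: cut_lt_neq0 bc.
case: bc => [bc|[]//]; have := cyc_shift a bc.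
rewrite add0r ![_ + a]addrC => /(cyc_between _)[] //.
by apply: (nocarry_lt_add ac); case: (cyc_neq bc) => _ _ /nesym.
Qed.

Lemma cut_le_add2l a b c : nocarry a c -> b ≼ c -> a + b ≼ a + c.
Proof. by move=> ac [->|]; [left|right; apply: cut_lt_add2l]. Qed.

Lemma cut_le_add a b c d : nocarry a c -> b ≼ a -> d ≼ c -> b + d ≼ a + c.
Proof.
move=> ac ba dc; apply: cut_le_trans (cut_le_add2l ac dc).
rewrite ![_ + d]addrC; apply: cut_le_add2l ba.
by apply: nocarryC; apply: nocarry_ler dc.
Qed.

Lemma cut_le_addKl a b c : nocarry a b -> a + b ≼ a + c -> b ≼ c.
Proof.
move=> ab abc; case: (cut_le_or_lt b c) => // /(cut_lt_add2l ab).
by move/(cut_le_not_lt abc).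
Qed.

Lemma cut_lt_addKl a b c : nocarry a b -> a + b ≺ a + c -> b ≺ c.
Proof.
move=> ab abc; case: (cut_le_addKl ab (cut_ltW abc)) => // bc.
by case: (cut_lt_neq abc); rewrite bc.
Qed.

(** In the cover both bracketings say that a + b + c < z. Away from the degenerate cases, adding b
    to c ≺ -(a + b) gives b + c ≺ -a. *)
Lemma nocarryA a b c : nocarry a b -> nocarry (a + b) c ->
  nocarry b c /\ nocarry a (b + c).
Proof.
move=> ab abc; have bab : b ≼ a + b by rewrite addrC; apply: nocarryC.
have bc : nocarry b c by apply: nocarryC; apply: nocarry_ler (nocarryC abc) bab.
split=> //.
have [->|/eqP a0] := eqVneq a 0; first by rewrite nocarryE; left.
have [ab0|/eqP ab0] := eqVneq (a + b) 0.
  by case: ab; rewrite ab0 // => /cut_lt_neq0.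
move: abc; rewrite !nocarryE => -[//|cab]; right.
have e : b - (a + b) = - a by rewrite opprD addrCA subrr addr0.
rewrite -e; apply: cut_lt_add2l => //.
rewrite /nocarry e.
by move: ab; rewrite nocarryE => -[//|]; right.
Qed.

Lemma cut_lt_sub2r a b c : a ≼ b -> b ≺ c -> b - a ≺ c - a.
Proof.
move=> ab bc; apply: (cut_lt_addKl (nocarry_subr ab)).
by rewrite !subrKC.
Qed.

Lemma cut_lt_sub2l a b c : a ≺ b -> b ≼ c -> c - b ≺ c - a.
Proof.
move=> ab bc; have h := nocarry_subr (cut_ltW ab).
have e : b - a + (c - b) = c - a by rewrite addrC addrA subrK.
have [hba _] : nocarry (b - a) (c - b) /\ nocarry a (b - a + (c - b)).
  by apply: nocarryA => //; rewrite subrKC; apply: nocarry_subr.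
rewrite -e [b - a + _]addrC; apply: nocarry_lt_add; first exact: nocarryC.
by move/eqP; rewrite subr_eq0 => /eqP/esym/(cut_lt_neq ab).
Qed.

Lemma subr_neq0 a b : a ≺ b -> b - a <> 0.
Proof. by move=> ab /eqP; rewrite subr_eq0 => /eqP/esym/(cut_lt_neq ab). Qed.

Lemma nocarryAC a b c : nocarry b c -> nocarry a (b + c) ->
  nocarry a b /\ nocarry (a + b) c.
Proof.
move=> bc abc.
have [||cb cba] := @nocarryA c b a; first exact: nocarryC.
  by apply: nocarryC; rewrite addrC.
by split; [|rewrite addrC]; apply: nocarryC.
Qed.

Lemma nocarryACA a b c d : nocarry a b -> nocarry c d ->
    nocarry (a + b) (c + d) ->
  [/\ nocarry a c, nocarry b d & nocarry (a + c) (b + d)].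
Proof.
move=> ab cd abcd.
have [bcd a_bcd] := nocarryA ab abcd.
have [bc bc_d] := nocarryAC cd bcd.
have [cb cb_d] := (nocarryC bc, bc_d); rewrite addrC in cb_d.
have [bd c_bd] := nocarryA cb cb_d.
have e : b + (c + d) = c + (b + d) by rewrite addrCA.
rewrite e in a_bcd.
by have [ac ac_bd] := nocarryAC c_bd a_bcd.
Qed.

(* The multiple k w, computed in the cover, is less than one turn. *)
Fixpoint nowrap k w : Prop :=
  if k is j.+1 then nowrap j w /\ nocarry (w *+ j) w else True.

(** * Multiples that stay below one turn *)

Lemma nowrapD j k w : nowrap (j + k) w <->
  [/\ nowrap j w, nowrap k w & nocarry (w *+ j) (w *+ k)].
Proof.
elim: k => [|k IHk].
  by rewrite addn0; split=> [?|[]//]; split=> //; apply: nocarry0r.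
rewrite addnS /= IHk mulrSr mulrnDr; split.
  by move=> [[Mj Mk jk] jk_w]; have [] := nocarryA jk jk_w.
by move=> [Mj [Mk kw] j_kw]; have [] := nocarryAC kw j_kw.
Qed.

Lemma nowrap_leq j k w : (j <= k)%N -> nowrap k w -> nowrap j w.
Proof. by move/subnKC <-; rewrite nowrapD => -[]. Qed.

Lemma cut_le_mulrn j k w : (j <= k)%N -> nowrap k w -> w *+ j ≼ w *+ k.
Proof. by move/subnKC <-; rewrite nowrapD mulrnDr => -[]. Qed.

Lemma cut_lt_mulrn j k w : w <> 0 -> (j < k)%N -> nowrap k w -> w *+ j ≺ w *+ k.
Proof.
move=> w0 jk Mk; apply: cut_lt_le_trans (cut_le_mulrn jk Mk); rewrite mulrSr.
by apply: nocarry_lt_add => //; case: (nowrap_leq jk Mk).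
Qed.

Lemma nowrap_le k v w : v ≼ w -> nowrap k w -> nowrap k v /\ v *+ k ≼ w *+ k.
Proof.
move=> vw; elim: k => [_|k IHk /= [/IHk[Mv vkw] kw]]; first by split; [|left].
rewrite !mulrSr; split; last exact: cut_le_add.
by split=> //; apply: nocarry_le kw _ _.
Qed.

Lemma nowrapM j k w : nowrap j w -> nowrap k (w *+ j) -> nowrap (k * j) w.
Proof.
move=> Mj; elim: k => [//|k IHk /= [/IHk Mk jw]].
rewrite mulSn nowrapD; split=> //; apply: nocarryC.
by rewrite mulnC mulrnA.
Qed.

Lemma nowrap_mulrn j k w : nowrap (k * j) w -> nowrap k (w *+ j).
Proof.
elim: k => [//|k IHk]; rewrite mulSn addnC nowrapD /= => -[/IHk Mk _ kjw].
by rewrite -mulrnA mulnC.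
Qed.

Lemma nowrap_addr k v w : (0 < k)%N -> nowrap k v -> nowrap k w ->
  nocarry (v *+ k) (w *+ k) -> nowrap k (v + w).
Proof.
case: k => // k _; elim: k => [|k IHk] Mv Mw.
  by split=> //=; rewrite mulr0n; apply: cut_le0.
have [Mv' kv] : nowrap k.+1 v /\ nocarry (v *+ k.+1) v := Mv.
have [Mw' kw] : nowrap k.+1 w /\ nocarry (w *+ k.+1) w := Mw.
rewrite [v *+ _]mulrSr [w *+ _]mulrSr => h.
have [kvw vw h'] := nocarryACA kv kw h.
have -> : nowrap k.+2 (v + w) =
  (nowrap k.+1 (v + w) /\ nocarry ((v + w) *+ k.+1) (v + w)) by [].
by split; [exact: IHk|rewrite mulrnDl].
Qed.

(* In terms of the cover: w is infinitesimal with respect to the full turn. *)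
Definition infinitesimal w : Prop := forall k, nowrap k w.

(** * Infinitesimals, and the linear order that they define *)

Lemma infinitesimal_le v w : v ≼ w -> infinitesimal w -> infinitesimal v.
Proof. by move=> vw iw k; case: (nowrap_le vw (iw k)). Qed.

Lemma infinitesimal_mulrn j w : infinitesimal w -> infinitesimal (w *+ j).
Proof. by move=> iw k; apply: nowrap_mulrn. Qed.

(** If v ≼ w, then v + w is bounded by 2 w, whose multiples are multiples of w. *)
Lemma infinitesimal_add v w : infinitesimal v -> infinitesimal w ->
  nocarry v w /\ infinitesimal (v + w).
Proof.
wlog vw : v w / v ≼ w => [hwlog iv iw|].
  case: (cut_le_total v w) => [/hwlog|/hwlog h]; first exact.
  by case: (h iw iv) => /nocarryC wv; rewrite addrC.
move=> _ iw; have ww : nocarry w w by case: (iw 2).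
split; first by apply: nocarryC; apply: nocarry_ler vw.
apply: infinitesimal_le (infinitesimal_mulrn 2 iw).
rewrite mulr2n; exact: cut_le_add (cut_le_refl w).
Qed.

(** The infinitesimals serve as the cone of nonnegative elements. Their sums do not wrap, so a chain
    a < b < c translates by -a to a chain of the cut order, whence [R a b c]. *)
Lemma linearly_cyclically_ordered_of_infinitesimal :
  (forall a, infinitesimal a \/ infinitesimal (- a)) ->
  linearly_cyclically_ordered R.
Proof.
move=> tot; pose lt a b := a <> b /\ infinitesimal (b - a).
have sub0 a b : a <> b -> b - a <> 0.
  by move=> ab /eqP; rewrite subr_eq0 => /eqP/esym.
have add_sub a b c : b - a + (c - b) = c - a by rewrite addrC addrA subrK.
have lt_R a b c : lt a b -> lt b c -> R a b c.
  move=> [nab iab] [nbc ibc]; have [cab _] := infinitesimal_add iab ibc.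
  have := nocarry_lt_add cab (sub0 _ _ nbc).
  rewrite add_sub => -[/(cyc_shift a)|[/(sub0 _ _ nab)//]].
  by rewrite add0r !subrK.
have lt_trans' a b c : lt a b -> lt b c -> lt a c.
  move=> ab bc; split; first by case: (cyc_neq (lt_R _ _ _ ab bc)).
  case: ab bc => _ iab [_ ibc]; rewrite -(add_sub a b c).
  by case: (infinitesimal_add iab ibc).
have lt_total' a b : a <> b -> lt a b \/ lt b a.
  move=> ab; case: (tot (b - a)) => [iab|]; first by left.
  by rewrite opprB; right; split=> // /esym.
exists lt; split; first split.
- split=> [a _ []//|a b c _ _ _|a b _ _]; [exact: lt_trans'|exact: lt_total'].
- move=> a b u [ab iab]; split; first by move/addIr.
  by rewrite opprD addrACA subrr addr0.
move=> a b c; split=> [abc|[] []]; last 3 first.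
- exact: lt_R.
- by move=> bc ca; do 2!apply: cyc_rot; apply: lt_R.
- by move=> ca ab; apply: cyc_rot; apply: lt_R.
(* Conversely, any order of a, b, c that is not a rotation of a < b < c contradicts the asymmetry of
   [R]. *)
have [ab bc ac] := cyc_neq abc.
have nR x y z : lt x y -> lt y z -> ~ R x z y.
  by move=> xy yz; apply: cyc_asym; apply: lt_R.
case: (lt_total' _ _ ab) => lab; case: (lt_total' _ _ bc) => lbc;
  case: (lt_total' _ _ ac) => lac.
- by constructor 1.
- by constructor 1.
- by case: (nR _ _ _ lac lbc).
- by constructor 3.
- by case: (nR _ _ _ lab lac); apply: cyc_rot.
- by constructor 2.
- by case: (nR c b a) => //; do 2!apply: cyc_rot.
- by case: (nR c b a) => //; do 2!apply: cyc_rot.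
Qed.

(** * Regularity read in the cut order *)

Definition cut_increasing n (f : nat -> G) : Prop :=
  forall i j, (i < j)%N -> (j < n)%N -> f i ≺ f j.

Lemma cut_increasing_sub n f a : cut_increasing n f -> a ≺ f 0%N ->
  cut_increasing n (fun i => f i - a).
Proof.
move=> hf af i j ij jn; apply: cut_lt_sub2r; last exact: hf.
apply: cut_ltW; case: (posnP i) => [->//|i0].
by apply: cut_lt_trans af _; apply: hf (ltn_trans ij jn).
Qed.

Lemma cyclic_seq_of_increasing (s : seq G) :
  cut_increasing (size s) (nth 0 s) -> cyclic_seq R s.
Proof.
move=> hs i j k ij jk ks; apply: cut_lt_cyc; apply: hs => //.
exact: ltn_trans jk ks.
Qed.

Lemma cyclic_seq0_increasing (s : seq G) :
  cyclic_seq R (0 :: s) -> cut_increasing (size s) (nth 0 s).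
Proof. by move=> hs i j ij js; left; apply: (hs 0%N i.+1 j.+1). Qed.

(* The conclusion of both regularity properties, read in the cover. *)
Definition cut_nth_part n x1 xn : Prop :=
  exists x, [/\ nowrap n x, x1 ≼ x *+ n & x *+ n ≼ xn].

Lemma has_nth_part_cut n x1 xn : (1 < n)%N -> x1 <> 0 ->
  cut_nth_part n x1 xn -> has_nth_part n R x1 xn.
Proof.
move=> n1 x10 [x [Mx x1x xxn]]; exists x.
have x0 : x <> 0.
  move=> x0; move: x1x; rewrite x0 mul0rn => /cut_le_not_lt; apply.
  exact: cut_lt0.
split.
  case: x1x => [->|x1x]; first by constructor 2.
  case: xxn => [->|xxn]; first by constructor 3.
  by constructor 1; apply: cut_lt_cyc.
apply: cyclic_seq_of_increasing => i j ij.
rewrite size_rcons size_mkseq ltnS => jn.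
have iltn := leq_trans ij jn.
rewrite !nth_rcons size_mkseq iltn nth_mkseq //.
move: jn; rewrite leq_eqVlt => /predU1P[->|jn].
  by rewrite ltnn eqxx; apply: cut_lt_le_trans xxn; apply: cut_lt_mulrn.
by rewrite jn nth_mkseq //; apply: cut_lt_mulrn (nowrap_leq (ltnW jn) Mx).
Qed.

(** The cyclic condition bounds only the multiples up to (n - 1) x. The last addition, of x to (n -
    1) x, cannot wrap because both terms lie below xn and 2 xn is less than one turn. *)
Lemma cut_has_nth_part n x1 xn : (1 < n)%N -> x1 ≺ xn -> nocarry xn xn ->
  has_nth_part n R x1 xn -> cut_nth_part n x1 xn.
Proof.
case: n => // n; rewrite ltnS => n0 x1n xnxn [x [hx hs]]; exists x.
have lt_s j k : (0 < j)%N -> (j < k)%N -> (k < n.+1)%N -> x *+ j ≺ x *+ k.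
  move=> j0 jk kn; left; have := hs 0%N j k j0 jk.
  rewrite size_rcons size_mkseq !nth_rcons size_mkseq kn (ltn_trans jk kn).
  by rewrite !nth_mkseq ?(ltn_trans jk kn) //; apply; apply: ltnW.
have lt_xn j : (0 < j)%N -> (j < n.+1)%N -> x *+ j ≺ xn.
  move=> j0 jn; left; have := hs 0%N j n.+1 j0 jn.
  rewrite size_rcons size_mkseq !nth_rcons size_mkseq jn ltnn eqxx.
  by rewrite !nth_mkseq //; apply.
have Mx j : (j <= n)%N -> nowrap j x.
  elim: j => // j IHj jn; split; first exact: IHj (ltnW jn).
  case: j jn {IHj} => [|j] jn; first by rewrite mulr0n; apply: cut_le0.
  by rewrite /nocarry -mulrSr; apply: cut_ltW; apply: lt_s.
have Mx' : nowrap n.+1 x.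
  split; first exact: Mx.
  apply: (nocarry_le xnxn); apply: cut_ltW; first exact: lt_xn.
  by rewrite -[x]mulr1n; apply: lt_xn.
case: hx => [/(cyc_between x1n)[]|->|->]; split=> //; try exact: cut_le_refl;
  exact: cut_ltW.
Qed.


Section Regular.
Variable n : nat.
Hypothesis n1 : (1 < n)%N.

Let n0 : (0 < n)%N := ltnW n1.
Let n1n : (n.-1 < n)%N. Proof. by rewrite prednK. Qed.
Let n0n : (0 < n.-1)%N. Proof. by rewrite -ltnS prednK. Qed.

Lemma cut_increasing_le f i : cut_increasing n f -> (i < n)%N ->
  f i ≼ f n.-1.
Proof.
move=> hf ik; have : (i <= n.-1)%N by rewrite -ltnS prednK.
by rewrite leq_eqVlt => /predU1P[->|h]; [left|right; apply: hf].
Qed.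

(* n-regularity read in the cover: f 0 < ... < f (n-1) are the x_i, and
   R(0, x_n, -x_n) says that twice x_n is less than one turn. *)
Definition cut_regular : Prop := forall f, cut_increasing n f -> f 0%N <> 0 ->
  nocarry (f n.-1) (f n.-1) -> cut_nth_part n (f 0%N) (f n.-1).

Lemma n_regular_cut : n_regular n R -> cut_regular.
Proof.
move=> reg f hf f0 fcarry.
have sz : size (mkseq f n) == n by rewrite size_mkseq.
have := reg (Tuple sz); rewrite /= -nth0 -nth_last size_mkseq !nth_mkseq //.
move=> h; apply: (cut_has_nth_part n1 _ fcarry); first exact: hf.
have nf : f n.-1 ≺ - f n.-1.
  move: fcarry; rewrite nocarryE => -[f0'|//].
  by case: (cut_lt_neq0 (hf _ _ n0n n1n)).
apply: h; apply: cyclic_seq_of_increasing => -[|i] [|j] //=; rewrite ltnS.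
  move=> _; rewrite size_rcons size_mkseq !ltnS => jn; apply: cut_lt0.
  rewrite nth_rcons size_mkseq; move: jn; rewrite leq_eqVlt => /predU1P[->|jn].
    by rewrite ltnn eqxx; apply: cut_lt_neq0 nf.
  rewrite jn nth_mkseq //; case: (posnP j) => [->//|j0].
  exact: cut_lt_neq0 (hf _ _ j0 jn).
move=> ij; rewrite size_rcons size_mkseq !ltnS => jn.
have iltn := leq_trans ij jn.
rewrite !nth_rcons size_mkseq iltn nth_mkseq //.
move: jn; rewrite leq_eqVlt => /predU1P[->|jn].
  by rewrite ltnn eqxx; apply: cut_le_lt_trans nf; apply: cut_increasing_le.
by rewrite jn nth_mkseq //; apply: hf.
Qed.

(** If x is an n-th part for the translated bounds, y + x is one for the original bounds. By
    contraposition, a counterexample stays a counterexample when translated by - n y. *)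
Lemma cut_nth_part_shift y x1 xn : nowrap n y -> y *+ n ≼ x1 -> x1 ≼ xn ->
  cut_nth_part n (x1 - y *+ n) (xn - y *+ n) -> cut_nth_part n x1 xn.
Proof.
move=> My yx1 x1n [x [Mx x1x xxn]]; exists (y + x).
have yn := nocarry_subr (cut_le_trans yx1 x1n).
have yx := nocarry_ler yn xxn.
split; first exact: nowrap_addr.
  by have := cut_le_add2l yx x1x; rewrite subrKC mulrnDl.
by have := cut_le_add2l yn xxn; rewrite subrKC mulrnDl.
Qed.

(** * A regular group with a missing n-th part has no standard element *)

Section Counterexample.
Variable f : nat -> G.
Hypothesis reg : cut_regular.
Hypothesis incr_f : cut_increasing n f.
Hypothesis f0_neq0 : f 0%N <> 0.
Hypothesis no_part : ~ cut_nth_part n (f 0%N) (f n.-1).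

(** The translated terms f i - n y admit no n-th part. If n w exceeded the last of them while 2 n w
    < z, regularity would apply to them, a contradiction. So n w is at most the last term, hence
    below the first one, as otherwise w itself would be an n-th part. *)
Lemma escape_step y w :
    nowrap n y -> y *+ n ≺ f 0%N -> nowrap n w ->
    w *+ n ≼ f n.-1 - y *+ n \/ nocarry (w *+ n) (w *+ n) ->
  nocarry (y *+ n) (w *+ n) /\ y *+ n + w *+ n ≺ f 0%N.
Proof.
move=> My yf Mw small; have f0n := cut_increasing_le incr_f n0.
have no_part' : ~ cut_nth_part n (f 0%N - y *+ n) (f n.-1 - y *+ n).
  by move=> h; apply/no_part/(cut_nth_part_shift My) => //; apply: cut_ltW.
have yfn := nocarry_subr (cut_le_trans (cut_ltW yf) f0n).
have fw : w *+ n ≼ f n.-1 - y *+ n.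
  case: small => // ww.
  case: (cut_le_or_lt (w *+ n) (f n.-1 - y *+ n)) => // fw.
  case: no_part'; apply: (reg (f := fun i => f i - y *+ n)).
  - exact: cut_increasing_sub.
  - exact: subr_neq0.
  - by apply: (nocarry_le ww); apply: cut_ltW.
have yw := nocarry_ler yfn fw; split=> //.
case: (cut_le_or_lt (f 0%N - y *+ n) (w *+ n)) => [fw0|].
  by case: no_part'; exists w.
by move/(cut_lt_add2l (nocarry_subr (cut_ltW yf))); rewrite subrKC.
Qed.

(** Iterating [escape_step] with y = k w keeps every k n w below [f 0], so no multiple of w ever
    completes a turn. *)
Lemma escape w : nowrap n w ->
    (forall y, nowrap n y -> y *+ n ≺ f 0%N ->
       w *+ n ≼ f n.-1 - y *+ n \/ nocarry (w *+ n) (w *+ n)) ->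
  infinitesimal w.
Proof.
move=> Mw small k; apply: (nowrap_leq (leq_pmulr k n0)).
suff: nowrap (k * n) w /\ w *+ (k * n) ≺ f 0%N by case.
elim: k => [|k [Mk kf]]; first by split=> //; rewrite mulr0n; apply: cut_lt0.
rewrite mulSn addnC nowrapD.
have My : nowrap n (w *+ k) by apply: nowrap_mulrn; rewrite mulnC.
rewrite mulrnA in kf.
have [] := escape_step My kf Mw (small _ My kf).
by rewrite mulrnDr -mulrnA => kw lt_f; split.
Qed.

Lemma infinitesimal_of_nowrap w : nowrap (2 * n) w -> infinitesimal w.
Proof.
rewrite mul2n -addnn nowrapD => -[Mw _ ww].
by apply: escape => // *; right.
Qed.

(** The first term and all successive differences are nonzero, hence at least e. *)
Lemma nowrap_least g e m : (forall v, v <> 0 -> e ≼ v) -> g 0%N <> 0 ->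
    cut_increasing m g ->
  forall i, (i < m)%N -> nowrap i.+1 e /\ e *+ i.+1 ≼ g i.
Proof.
move=> least g0 hg; elim=> [_|i IHi im].
  by split; [split=> //=; apply: cut_le0|rewrite mulr1n; apply: least].
have [Me eg] := IHi (ltnW im).
have lt_eg : e *+ i.+1 ≺ g i.+1 by apply: cut_le_lt_trans eg _; apply: hg.
have h := nocarry_subr (cut_ltW lt_eg).
have le_e : e ≼ g i.+1 - e *+ i.+1 by apply/least/subr_neq0.
split; first by split=> //; apply: nocarry_ler le_e.
by have := cut_le_add2l h le_e; rewrite subrKC -mulrSr.
Qed.

(** A translate of f still has n increasing nonzero terms, so its last term is at least n e. This
    supplies the first alternative required by [escape], without bounding 2 n e by a turn. *)
Lemma infinitesimal_least e : (forall v, v <> 0 -> e ≼ v) -> infinitesimal e.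
Proof.
move=> least.
have bound g : cut_increasing n g -> g 0%N <> 0 ->
    nowrap n e /\ e *+ n ≼ g n.-1.
  by move=> hg g0; have := nowrap_least least g0 hg n1n; rewrite prednK.
apply: escape => [|y My yf]; first by case: (bound f).
left; case: (bound (fun i => f i - y *+ n)) => //.
  exact: cut_increasing_sub.
exact: subr_neq0.
Qed.

Let standard w := ~ infinitesimal w /\ ~ infinitesimal (- w).

(** Without a maximal k, induction would produce standard elements with arbitrarily many multiples
    below one turn; 2 n of them already force infinitesimality. *)
Lemma standard_minimal w0 : standard w0 ->
  exists w k, [/\ standard w, nowrap k w &
    forall v, standard v -> ~ nowrap k.+1 v].
Proof.
move=> st0; apply: NNPP => nmax.
have st k : exists2 w, standard w & nowrap k w.
  elim: k => [|k [w stw Mw]]; first by exists w0.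
  apply: NNPP => nk; apply: nmax; exists w, k; split=> // v stv Mv.
  by apply: nk; exists v.
have [w [infw _]] := st (2 * n)%N.
by move/infinitesimal_of_nowrap.
Qed.

Lemma infinitesimal_lt_standard d w : infinitesimal d -> standard w -> d ≺ w.
Proof.
move=> infd [nw _]; case: (cut_le_or_lt w d) => // wd.
by case: nw; apply: infinitesimal_le wd infd.
Qed.

Lemma no_standard w0 : ~ standard w0.
Proof.
move/standard_minimal => [w [k [[nw nNw] Mk maxk]]].
have stw : standard w by [].
have k0 : (0 < k)%N.
  case: (posnP k) => // k0; case: (maxk w stw); rewrite k0.
  by split=> //=; apply: cut_le0.
(* If u were standard, its first 2 k multiples would not wrap, and 2 k > k contradicts
   maximality. *)
have half v u : nowrap k v -> nocarry u u -> u + u ≼ v ->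
    infinitesimal u \/ infinitesimal (- u).
  move=> Mv uu uuv; apply: NNPP => st.
  have stu : standard u by split=> ?; apply: st; [left|right].
  have M2u : nowrap 2 u by split; [split=> //; apply: cut_le0|].
  have [] := nowrap_le uuv Mv; rewrite -mulr2n => Mku _.
  case: (maxk u stu); apply: nowrap_leq (nowrapM M2u Mku).
  by rewrite muln2 -addnn -addn1 leq_add2l.
case: (classic (exists2 d, d <> 0 & infinitesimal d)) => [[d d0 infd]|no_inf].
  have [v [stv vv Mv]] : exists v, [/\ standard v, nocarry v v & nowrap k v].
    (* If 2 w wraps, then k is at most 1, so any element may replace w as far as [nowrap k] is
       concerned. *)
    have [ww|nww] := classic (nocarry w w); first by exists w.
    have k1 : (k <= 1)%N.
      by rewrite leqNgt; apply/negP => /nowrap_leq /(_ Mk)[].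
    have M1 u : nowrap k u.
      by apply: nowrap_leq k1 _; split=> //; apply: cut_le0.
    have [ww|nNww] := classic (nocarry (- w) (- w)).
      by exists (- w); split=> //; split; rewrite ?opprK.
    (* Neither w nor -w is below half a turn, so 2 w is exactly one turn; w - d then falls just
       below half. *)
    have wNw : w = - w.
      case: (cut_lt_total w (- w)) => // lt_w.
        by case: nww; rewrite nocarryE; right.
      by case: nNww; rewrite nocarryE opprK; right.
    have dw := infinitesimal_lt_standard infd stw.
    have h := nocarry_subr (cut_ltW dw).
    have lt_wd : w ≺ w + d.
      apply: nocarry_lt_add => //.
      by rewrite nocarryE -wNw; right.
    have e : - (w - d) = w + d by rewrite opprB addrC -wNw.
    exists (w - d); split=> //; last first.
      rewrite nocarryE e; right; apply: cut_lt_trans lt_wd.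
      have := nocarry_lt_add (nocarryC h) d0.
      by rewrite subrK.
    split=> [infw|]; last first.
      rewrite e => infw; apply: nw.
      exact: infinitesimal_le (cut_ltW lt_wd) infw.
    by have [_] := infinitesimal_add infd infw; rewrite subrKC.
  have lt_v j : d *+ j ≺ v.
    by apply: infinitesimal_lt_standard => //; apply: infinitesimal_mulrn.
  have [|||x [Mx x1x xv]] := reg (f := fun i => v - d *+ (n.-1 - i)).
  - move=> i j ij jn; apply: cut_lt_sub2l (cut_ltW (lt_v _)).
    apply: cut_lt_mulrn => //; apply: ltn_sub2l => //.
    by apply: leq_trans ij _; rewrite -ltnS prednK.
  - exact: subr_neq0.
  - by rewrite subnn mulr0n subr0.
  rewrite subn0 in x1x; rewrite subnn mulr0n subr0 in xv.
  have [_ xx] : nowrap 2 x := nowrap_leq n1 Mx.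
  have x_le_v : x ≼ v.
    by apply: cut_le_trans xv; rewrite -{1}[x]mulr1n; apply: cut_le_mulrn.
  have xxv : x + x ≼ v.
    by apply: cut_le_trans xv; rewrite -mulr2n; apply: cut_le_mulrn.
  (* As n is at least 2, 2 x ≼ v and [half] applies. If -x were infinitesimal and nonzero, it would
     lie below the standard element -v, putting x above v. *)
  have infx : infinitesimal x.
    case: (half v x Mv xx xxv) => // infNx.
    have [x0|/eqP x0] := eqVneq x 0; first by move: infNx; rewrite x0 oppr0.
    have stNv : standard (- v) by case: stv => ? ?; split; rewrite ?opprK.
    have Nx0 : - x <> 0 by move/eqP; rewrite oppr_eq0 => /eqP.
    have := cut_lt_opp Nx0 (infinitesimal_lt_standard infNx stNv).
    rewrite !opprK.
    by move/(cut_le_not_lt x_le_v).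
  (* The bound v - (n - 1) d ≼ n x places v below the infinitesimal (n - 1) d + n x. *)
  have [dx inf_dx] := infinitesimal_add (infinitesimal_mulrn n.-1 infd)
    (infinitesimal_mulrn n infx).
  case: stv => + _; apply; apply: infinitesimal_le inf_dx.
  by have := cut_le_add2l dx x1x; rewrite subrKC.
(* Otherwise w is the least nonzero element. *)
apply: nw; apply: infinitesimal_least => v v0.
case: (cut_le_or_lt w v) => // vw; case: no_inf.
have h := nocarry_subr (cut_ltW vw).
(* The smaller of v and w - v, whose sum is w; [half] then turns it or its opposite into a nonzero
   infinitesimal. *)
have [u [u0 uu uuw]] : exists u, [/\ u <> 0, nocarry u u & u + u ≼ w].
  case: (cut_le_total v (w - v)) => uv.
    exists v; split=> //; first exact: nocarry_ler uv.
    by have := cut_le_add2l h uv; rewrite subrKC.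
  exists (w - v); split; first exact: subr_neq0.
    by apply: nocarry_ler uv; apply: nocarryC.
  by have := cut_le_add2l (nocarryC h) uv; rewrite subrK.
case: (half w u Mk uu uuw) => infu; [exists u|exists (- u)] => //.
by move/eqP; rewrite oppr_eq0 => /eqP.
Qed.

End Counterexample.

(** A missing n-th part rules out standard elements, so every a or its opposite is infinitesimal and
    the group is linear. *)
Lemma n_regular_c_n_regular : n_regular n R ->
  ~ linearly_cyclically_ordered R -> c_n_regular n R.
Proof.
move=> /n_regular_cut reg notlin x hx.
have incr := cyclic_seq0_increasing hx; rewrite size_tuple in incr.
have x1_neq0 : x`_0 <> 0.
  have /cyc_neq[/nesym] // : R 0 x`_0 x`_1.
  by apply: (hx 0%N 1%N 2%N); rewrite //= size_tuple.
rewrite -nth0 -nth_last size_tuple; apply: has_nth_part_cut => //.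
apply: NNPP => no_part; apply: notlin.
apply: linearly_cyclically_ordered_of_infinitesimal => a.
apply: NNPP => na; apply: (no_standard reg incr x1_neq0 no_part (w0 := a)).
by split=> ?; apply: na; [left|right].
Qed.

Lemma c_n_regular_n_regular : c_n_regular n R -> n_regular n R.
Proof.
move=> creg x hx; apply: creg => i j k ij jk; rewrite /= size_tuple ltnS => kn.
have := hx i j k ij jk; rewrite /= size_rcons size_tuple ltnS => /(_ (leqW kn)).
have nth_x l : (l <= n)%N ->
    (0 :: rcons x (- last 0 x))`_l = (0 :: x)`_l.
  by case: l => //= l ln; rewrite nth_rcons size_tuple ln.
by rewrite !nth_x // ?(ltnW (leq_trans jk kn)) // (leq_trans (ltnW ij)) //
   (leq_trans (ltnW jk)).
Qed.

(** * Comparison with a linear order inducing [R] *)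

Section Linear.
Variable lt : G -> G -> Prop.
Hypothesis lt_R : induced_by lt R.

Lemma linear_irr a : ~ lt a a.
Proof. by case: lt_R => -[[irr _ _] _] _; apply: irr. Qed.

Lemma linear_trans b a c : lt a b -> lt b c -> lt a c.
Proof. by case: lt_R => -[[_ tr _] _] _; apply: tr. Qed.

Lemma linear_add2r u a b : lt a b -> lt (a + u) (b + u).
Proof. by case: lt_R => -[_ add] _; apply: add. Qed.

Lemma linear_total a b : a <> b -> lt a b \/ lt b a.
Proof. by case: lt_R => -[[_ _ tot] _] _; apply: tot. Qed.

Lemma linear_cut a b : lt 0 a -> lt a b -> a ≺ b.
Proof. by move=> a0 ab; left; case: lt_R => _ ->; constructor 1. Qed.

(** Cutting at 0 places all positive elements before all negative ones. *)
Lemma cut_linear a b : lt 0 b -> a <> 0 -> a ≺ b -> lt 0 a /\ lt a b.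
Proof.
move=> b0 a0 [|[]//]; case: lt_R => _ -> [//|[_]|[]] /(linear_trans b0) h.
  by case: (linear_irr h).
by move=> _; case: (linear_irr h).
Qed.

Lemma linear_mulrn_gt0 k a : (0 < k)%N -> lt 0 a -> lt 0 (a *+ k).
Proof.
move=> + a0; case: k => // k _; elim: k => // k IHk.
rewrite mulrSr; apply: linear_trans a0 _.
by rewrite -{1}[a]add0r; apply: linear_add2r.
Qed.

Lemma linear_opp a : lt a 0 -> lt 0 (- a).
Proof. by move/(linear_add2r (- a)); rewrite subrr add0r. Qed.

Lemma linear_mulrn_gt0_inv k a : lt 0 (a *+ k) -> lt 0 a.
Proof.
case: k => [/linear_irr//|k] ak0.
have [a0|/eqP/linear_total[/linear_opp a0|//]] := eqVneq a 0.
  by move: ak0; rewrite a0 mul0rn => /linear_irr.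
have := linear_mulrn_gt0 (ltn0Sn k) a0; rewrite mulNrn.
move/(linear_add2r (a *+ k.+1)); rewrite add0r addNr.
by move/(linear_trans ak0)/linear_irr.
Qed.

Lemma linear_nowrap k a : lt 0 a -> nowrap k a.
Proof.
move=> a0; elim: k => //= k IHk; split=> //.
case: (posnP k) => [->|k0]; first by rewrite mulr0n; apply: cut_le0.
rewrite /nocarry -mulrSr; right; apply: linear_cut.
  exact: linear_mulrn_gt0.
rewrite mulrSr -[X in lt X _]add0r [a *+ k + a]addrC.
exact: linear_add2r.
Qed.

Lemma linear_seq_increasing (s : seq G) : increasing_seq lt (0 :: s) ->
  forall i j, (i < j)%N -> (j <= size s)%N -> lt (0 :: s)`_i (0 :: s)`_j.
Proof.
move=> hs i; elim=> // j IHj; rewrite ltnS leq_eqVlt => /predU1P[->|ij] js.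
  exact: hs.
by apply: linear_trans (hs _ js); apply: IHj => //; apply: ltnW.
Qed.

(** Positive elements increase in the cut order too, and the double of a positive element never
    completes a turn, so [cut_regular] applies to the tuple. *)
Lemma n_regular_linear : n_regular n R -> linear_n_regular n lt.
Proof.
move=> /n_regular_cut reg x /linear_seq_increasing; rewrite size_tuple => hx.
have x_gt0 i : (i < n)%N -> lt 0 x`_i by move=> i_n; apply: (hx 0%N i.+1).
have lt_neq0' a : lt 0 a -> a <> 0 by move=> + a0; rewrite a0 => /linear_irr.
have xn_gt0 := x_gt0 _ n1n.
rewrite -nth0 -nth_last size_tuple.
have [|||y [_ x1y yxn]] := reg (nth 0 x).
- move=> i j ij jn; apply: linear_cut (x_gt0 _ (ltn_trans ij jn)) _.
  exact: (hx i.+1 j.+1).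
- exact/lt_neq0'/x_gt0.
- rewrite nocarryE; right; left; case: lt_R => _ ->; constructor 3; split=> //.
  by have := linear_add2r (- x`_n.-1) xn_gt0; rewrite add0r subrr.
have yn_neq0 : y *+ n <> 0.
  move=> yn0; move: x1y; rewrite yn0 => /cut_le_not_lt; apply.
  exact/cut_lt0/lt_neq0'/x_gt0.
have yn_gt0 : lt 0 (y *+ n).
  by case: yxn => [->//|/(cut_linear xn_gt0 yn_neq0)[]].
exists y; split; [case: x1y|case: yxn]; try by right.
  by case/(cut_linear yn_gt0 (lt_neq0' _ (x_gt0 _ n0))); left.
by case/(cut_linear xn_gt0 yn_neq0); left.
Qed.

Lemma linear_n_regular_n_regular : linear_n_regular n lt -> n_regular n R.
Proof.
move=> reg x hx; have incr := cyclic_seq0_increasing hx.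
rewrite size_rcons size_tuple in incr.
have nth_x i : (i < n)%N -> (rcons x (- last 0 x))`_i = x`_i.
  by move=> i_n; rewrite nth_rcons size_tuple i_n.
have lt_x i j : (i < j)%N -> (j < n)%N -> x`_i ≺ x`_j.
  move=> ij jn; have := incr i j ij (ltnW jn).
  by rewrite !nth_x // (ltn_trans ij jn).
have x_neq0 i : (i < n)%N -> x`_i <> 0.
  move=> i_n; set s := 0 :: rcons x (- last 0 x).
  have /cyc_neq[/nesym + _ _] : R 0 s`_i.+1 s`_n.+1.
    by apply: (hx 0%N i.+1 n.+1); rewrite //= size_rcons size_tuple.
  by rewrite /= nth_x.
(* This is the use of -x_n in the hypothesis: a negative x_n would come after its positive opposite
   in the cut order. *)
have xn_gt0 : lt 0 x`_n.-1.
  have : x`_n.-1 ≺ - x`_n.-1.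
    have := incr n.-1 n n1n (ltnSn n); rewrite nth_x // nth_rcons size_tuple.
    by rewrite ltnn eqxx -nth_last size_tuple.
  case: (linear_total (nesym (x_neq0 _ n1n))) => // /linear_opp xn0.
  by case/(cut_linear xn0 (x_neq0 _ n1n)).
have x_gt0 i : (i < n)%N -> lt 0 x`_i.
  move=> i_n; case: (cut_increasing_le lt_x i_n) => [->//|].
  by case/(cut_linear xn_gt0 (x_neq0 _ i_n)).
have [|y] := reg x.
  move=> [|i]; rewrite /= size_tuple ltnS => i_n; first exact: x_gt0.
  by case: (cut_linear (x_gt0 _ i_n) (x_neq0 i (ltnW i_n)) (lt_x i i.+1 _ _)).
rewrite -nth0 -nth_last size_tuple => -[x1y yxn].
have yn_gt0 : lt 0 (y *+ n).
  by case: x1y => [/(linear_trans (x_gt0 _ n0))//|<-]; apply: x_gt0.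
apply: has_nth_part_cut (x_neq0 _ n0) _ => //.
exists y; split; first exact/linear_nowrap/linear_mulrn_gt0_inv/yn_gt0.
  by case: x1y => [|->]; [right; apply: linear_cut => //; apply: x_gt0|left].
by case: yxn => [|->]; [right; apply: linear_cut|left].
Qed.

End Linear.

End Regular.

End CyclicOrder.

Theorem theorem3p8 (G : zmodType) (R : G -> G -> G -> Prop) (n : nat)
    (hn : (2 <= n)%N) (hR : is_cyclic_order R) :
  (n_regular n R <->
     n_regular_linearly_cyclically_ordered n R
     \/ (~ linearly_cyclically_ordered R /\ c_n_regular n R))
  /\
  (n_regular n R <->
     n_regular_linearly_cyclically_ordered n R \/ c_n_regular n R).
Proof.
have split_reg : n_regular n R -> n_regular_linearly_cyclically_ordered n R
    \/ (~ linearly_cyclically_ordered R /\ c_n_regular n R).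
  move=> reg; case: (classic (linearly_cyclically_ordered R)) => lin.
    case: lin => lt lt_R; left; exists lt; split=> //.
    exact: n_regular_linear reg.
  by right; split=> //; apply: n_regular_c_n_regular.
have join_reg : n_regular_linearly_cyclically_ordered n R \/ c_n_regular n R ->
    n_regular n R.
  case=> [[lt [lt_R reg]]|]; last exact: c_n_regular_n_regular.
  exact: linear_n_regular_n_regular reg.
split; split=> //.
- by case=> [lin|[_ creg]]; apply: join_reg; [left|right].
- by move/split_reg => -[lin|[_ creg]]; [left|right].
Qed.
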